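(* (i) For any odd integer $n>1$, we have $$s_n:=\frac{2^{(n-1)/2}}{\sqrt n}\operatorname{per}\left[\sin2\pi\frac{jk}{n}\right]_{1\le j,k\le (n-1)/2}\in\mathbb Z.$$ (ii) Let $p$ be any odd prime. Then $$s_p':=\frac{\sqrt p}{2^{(p-1)/2}}\operatorname{per}\left[\csc2\pi\frac{jk}{p}\right]_{1\le j,k\le (p-1)/2}\in\mathbb Z.$$ (iii) For any odd prime $p$, we have $$s_p\equiv(-1)^{(p+1)/2}\pmod p\quad\text{and}\quad s_p'\equiv1\pmod p.$$
   Context: The permanent of an $N\times N$ matrix $A=[a_{j,k}]$ is $\operatorname{per}(A)=\sum_{\tau\in S_N}\prod_{j=1}^{N}a_{j,\tau(j)}$. $\sin2\pi\frac{m}{n}$ means $\sin(2\pi m/n)$, and $\csc=1/\sin$. *)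

(* Defs.v *)
From mathcomp Require Import all_boot all_order all_fingroup all_algebra.
From mathcomp Require Import reals trigo.

Set Implicit Arguments.
Unset Strict Implicit.
Unset Printing Implicit Defensive.

Import Order.TTheory GRing.Theory Num.Theory.
Local Open Scope ring_scope.

Definition permanent (R : comPzRingType) (N : nat) (A : 'M[R]_N) : R :=
  \sum_(t : 'S_N) \prod_(j < N) A j (t j).

Definition csc (R : realType) (x : R) : R := (sin x)^-1.

(* The ordinals start at 0, so the entry at (j, k) in 1-based indexing is the
   one at (j - 1, k - 1) here. *)
Definition sin_mx (R : realType) (n : nat) : 'M[R]_((n - 1)./2) :=
  \matrix_(j, k) sin (2 * pi * ((j.+1 * k.+1)%:R / n%:R)).

Definition csc_mx (R : realType) (n : nat) : 'M[R]_((n - 1)./2) :=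
  \matrix_(j, k) csc (2 * pi * ((j.+1 * k.+1)%:R / n%:R)).

Definition sin_per (R : realType) (n : nat) : R :=
  2 ^+ (n - 1)./2 / Num.sqrt n%:R * permanent (sin_mx R n).

Definition csc_per (R : realType) (p : nat) : R :=
  Num.sqrt p%:R / 2 ^+ (p - 1)./2 * permanent (csc_mx R p).

(* Main.v *)
Require Import Defs.
From mathcomp Require Import all_boot all_order all_fingroup all_algebra.
From mathcomp Require Import finfield.
From mathcomp Require Import reals trigo.
From mathcomp Require Import zify ring.

(** Put N = (n-1)/2, theta_j = 2 pi j / n, and write
    U_m(x) = sin (m x) / sin x, an integer polynomial in 2 cos x.

    The whole argument rests on
    prod_(1 <= j <= N) 2 sin theta_j = sqrt n (prod_2sin_angle).
    Row by row, it turns the normalizing factors into 1: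
    s_n = per [U_k(theta_j)], and, choosing k* with k k* = 1 mod p so that
    sin theta_j = sin (k k* theta_j), also s'_p = per [U_(k* )(k theta_j)]
    (sin_perE, csc_perE).  Thus no sign of a Gauss sum has to be determined.

    What remains is a statement about permanents whose k-th column is the list
    of values of one integer polynomial at the conjugate numbers
    2 cos theta_j.  Such a permanent is symmetric in these conjugates, hence an
    integer.  Concretely, Ryser's formula (permanent_ryser) writes it as an
    alternating sum of products prod_j d_j, where d is a sum of columns.
    Multiplying row j of the sine matrix S = [sin (k theta_j)] by
    2 cos (m theta_j) amounts to multiplying S on the right by an integer
    matrix, because 2 cos a sin b = sin (b+a) + sin (b-a) and every
    sin (m theta_j) is 0 or up to sign an entry of row j.  The functions d of j
    with such an integer matrix M (S M = diag(d) S, see int_multiplier) form a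
    ring, and since S is invertible, prod_j d_j = det M is an integer.

    Modulo an odd prime n = p all the conjugates 2 cos theta_j reduce to 2: the
    binomial expansion of (2 cos x)^p gives (2 cos theta_j)^p = 2 + p h_j with
    h again in the ring (frob_residue_cos).  By additivity of the Frobenius
    map, U_m(t theta_j)^p = m + p h_j for another such h.  If d^p = c + p h,
    then (prod_j d_j)^p = det (c + p H) = c^N mod p for an integer matrix H, and
    Fermat's little theorem removes the exponent p.  Undoing Ryser's formula,
    s_p = per [k] = (N!)^2 and s'_p = per [k*] = N! prod_k k* = 1 mod p, and
    Wilson's theorem evaluates (N!)^2. *)

Set Implicit Arguments.
Unset Strict Implicit.
Unset Printing Implicit Defensive.

Import Order.TTheory GRing.Theory Num.Theory.
Local Open Scope ring_scope.

(** * Ryser's formula *)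

Lemma permanent_perm_on (K : comPzRingType) (N : nat) (A : 'M[K]_N) :
  permanent A = \sum_(f : {ffun 'I_N -> 'I_N} | injectiveb f)
                   \prod_j A j (f j).
Proof.
rewrite (reindex (@pval _)) /=; last first.
  pose in_Sn := insubd (1%g : 'S_N).
  by exists in_Sn => /= f Uf; first apply: val_inj; apply: insubdK.
apply: eq_big => [s | s _]; first by rewrite (valP s).
by apply: eq_bigr => j _; rewrite pvalE.
Qed.

(** After expanding both sides over all maps f, the coefficient of
    prod_j A_(j, f j) is the alternating sum over the sets J containing the
    image of f; written as prod_k (1 - [k not in the image of f]), it is 1 when
    f is onto and 0 otherwise. *)
Lemma permanent_ryser (K : comPzRingType) (N : nat) (A : 'M[K]_N) :
  permanent A = \sum_(J : {set 'I_N})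
                  (-1) ^+ #|~: J| * \prod_j \sum_(k in J) A j k.
Proof.
transitivity (\sum_(J : {set 'I_N}) \sum_(f : {ffun 'I_N -> 'I_N})
    (\prod_j A j (f j)) *
    \prod_k (if k \in J then 1 else - (k \notin codom f)%:R)).
  rewrite permanent_perm_on exchange_big big_mkcond /=; apply: eq_bigr => f _.
  rewrite -big_distrr -bigA_distr /=.
  case: injectiveP => [f_inj|f_ninj].
    rewrite [X in _ * X]big1 ?mulr1 // => k _.
    by rewrite -(f_invF f_inj k) codom_f subr0.
  suff [k kNf] : exists k, k \notin codom f.
    by rewrite [X in _ * X](bigD1 k) //= kNf subrr mul0r mulr0.
  apply/existsP; rewrite -negb_forall; apply/negP => /forallP f_onto.
  apply: f_ninj; apply/injectiveP; rewrite /injectiveb /dinjectiveb.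
  apply/card_uniqP; rewrite size_map -cardT -/(codom f).
  by apply: eq_card => k; rewrite f_onto.
apply: eq_bigr => J _.
under [in RHS]eq_bigr => j _ do rewrite big_mkcond.
rewrite bigA_distr_bigA big_distrr /=; apply: eq_bigr => f _.
have [fJ|] := boolP [forall j, f j \in J].
  rewrite [RHS]mulrC; congr (_ * _).
    by apply: eq_bigr => j _; rewrite (forallP fJ).
  rewrite -prodr_const [LHS](bigID (mem J)) /= big1 ?mul1r; last by move=> k ->.
  apply: eq_big => [k|k kJ]; first by rewrite inE.
  rewrite (negPf kJ); suff -> : k \notin codom f by [].
  by apply: contra kJ => /codomP [j ->]; apply: (forallP fJ).
rewrite negb_forall => /existsP [j fjJ].
rewrite [X in _ * X](bigD1 (f j)) //= (negPf fjJ) codom_f oppr0 mul0r mulr0.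
by rewrite [in RHS](bigD1 j) //= (negPf fjJ) mul0r mulr0.
Qed.

(** * Integer multipliers of a matrix *)

(** When S is invertible, this says that d lists the eigenvalues of an integer
    matrix whose left eigenvectors are the rows of S. With the eigenvectors
    fixed, such lists form a ring under pointwise operations. *)
Definition int_multiplier (R : numFieldType) (N : nat) (S : 'M[R]_N)
    (d : 'I_N -> R) : Prop :=
  exists M : 'M[int]_N, S *m map_mx intr M = diag_mx (\row_j d j) *m S.

(** A substitute for the congruence of d and c modulo the primes above p: the
    Frobenius image of d is c (which is c^p modulo p), modulo p times the ring
    of multipliers. *)
Definition frob_residue (R : numFieldType) (p N : nat) (S : 'M[R]_N)
    (d : 'I_N -> R) (c : int) : Prop :=
  int_multiplier S d /\ exists2 h, int_multiplier S h &
    forall j, d j ^+ p = c%:~R + p%:R * h j.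

Section IntMultiplier.

Context (R : numFieldType) (N : nat) (S : 'M[R]_N).
Implicit Types (d e h : 'I_N -> R) (c : int) (p : nat).

Lemma eq_int_multiplier d e :
  d =1 e -> int_multiplier S d -> int_multiplier S e.
Proof.
move=> de [M SM]; exists M; rewrite SM; congr (diag_mx _ *m _).
by apply/rowP => j; rewrite !mxE de.
Qed.

Lemma int_multiplierC c : int_multiplier S (fun=> c%:~R).
Proof.
exists c%:M; rewrite map_scalar_mx mul_mx_scalar -mul_scalar_mx.
congr (_ *m _); rewrite -diag_const_mx; congr diag_mx.
by apply/rowP=> j; rewrite !mxE.
Qed.

Lemma int_multiplierD d e :
  int_multiplier S d -> int_multiplier S e ->
  int_multiplier S (fun j => d j + e j).
Proof.
move=> [M SM] [M' SM']; exists (M + M').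
rewrite map_mxD mulmxDr SM SM' -mulmxDl -raddfD; congr (diag_mx _ *m _).
by apply/rowP => j; rewrite !mxE.
Qed.

Lemma int_multiplierM d e :
  int_multiplier S d -> int_multiplier S e ->
  int_multiplier S (fun j => d j * e j).
Proof.
move=> [M SM] [M' SM']; exists (M *m M').
rewrite map_mxM mulmxA SM -mulmxA SM' mulmxA mulmx_diag; congr (diag_mx _ *m _).
by apply/rowP => j; rewrite !mxE.
Qed.

Lemma int_multiplierX d i :
  int_multiplier S d -> int_multiplier S (fun j => d j ^+ i).
Proof.
move=> Md; elim: i => [|i IHi]; first exact: (int_multiplierC 1).
by apply: eq_int_multiplier (int_multiplierM Md IHi) => j; rewrite exprS.
Qed.

Lemma int_multiplier_sum (I : Type) (s : seq I) (P : pred I)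
    (F : I -> 'I_N -> R) :
  (forall i, P i -> int_multiplier S (F i)) ->
  int_multiplier S (fun j => \sum_(i <- s | P i) F i j).
Proof.
move=> MF; elim: s => [|i s IHs].
  by apply: eq_int_multiplier (int_multiplierC 0) => j; rewrite big_nil.
case Pi: (P i); last first.
  by apply: eq_int_multiplier IHs => j; rewrite big_cons Pi.
apply: eq_int_multiplier (int_multiplierD (MF i Pi) IHs) => j.
by rewrite big_cons Pi.
Qed.

Lemma eq_frob_residue p d e c :
  d =1 e -> frob_residue p S d c -> frob_residue p S e c.
Proof.
move=> de [Md [h Mh dh]]; split; first exact: eq_int_multiplier Md.
by exists h => // j; rewrite -de.
Qed.

Lemma frob_residueD p d e a b : prime p ->
  frob_residue p S d a -> frob_residue p S e b ->
  frob_residue p S (fun j => d j + e j) (a + b).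
Proof.
move=> p_pr [Md [h Mh dh]] [Me [g Mg eg]].
split; first exact: int_multiplierD.
exists (fun j => h j + g j + \sum_(i < p.+1 | (0 < i < p)%N)
           ('C(p, i) %/ p)%N%:Z%:~R * (d j ^+ (p - i) * e j ^+ i)).
  apply: int_multiplierD; first exact: int_multiplierD.
  apply: int_multiplier_sum => i _; apply: int_multiplierM.
    exact: int_multiplierC.
  by apply: int_multiplierM; apply: int_multiplierX.
have p_gt0 := prime_gt0 p_pr.
move=> j; rewrite exprDn (bigD1 ord0) //= (bigD1 ord_max) /=; last first.
  by rewrite -val_eqE /= -lt0n.
(* Only the binomial coefficients strictly between the extreme ones are
   divisible by p. *)
rewrite bin0 binn !mulr1n subn0 subnn !expr0 mulr1 mul1r dh eg.
rewrite intrD !mulrDr big_distrr /= !addrA; congr (_ + _).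
  by congr (_ + _); rewrite addrAC.
apply: eq_big => [i|i].
  by rewrite -!val_eqE /= lt0n ltn_neqAle -ltnS ltn_ord andbT.
rewrite -!val_eqE /= -lt0n => /andP[i_gt0 i_ne].
have i_lt : (i < p)%N by rewrite ltn_neqAle i_ne -ltnS ltn_ord.
have pC : (p %| 'C(p, i))%N by rewrite prime_dvd_bin // i_gt0.
by rewrite -pmulrn -mulr_natl -{1}(divnK pC) mulnC natrM !mulrA.
Qed.

Lemma frob_residue0 p : prime p -> frob_residue p S (fun=> 0) 0.
Proof.
move=> p_pr; split; first exact: (int_multiplierC 0).
exists (fun=> 0); first exact: (int_multiplierC 0).
by move=> j; rewrite expr0n gtn_eqF ?prime_gt0 // mulr0 addr0.
Qed.

Lemma frob_residue_sum p (I : Type) (s : seq I) (P : pred I)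
    (F : I -> 'I_N -> R) (c : I -> int) : prime p ->
  (forall i, P i -> frob_residue p S (F i) (c i)) ->
  frob_residue p S (fun j => \sum_(i <- s | P i) F i j)
                   (\sum_(i <- s | P i) c i).
Proof.
move=> p_pr rF; elim: s => [|i s IHs].
  rewrite big_nil; apply: eq_frob_residue (frob_residue0 p_pr) => j.
  by rewrite big_nil.
rewrite big_cons; case: ifP => [Pi|nPi].
  apply: eq_frob_residue (frob_residueD p_pr (rF i Pi) IHs) => j.
  by rewrite big_cons Pi.
by apply: eq_frob_residue IHs => j; rewrite big_cons nPi.
Qed.

(** Comparing determinants in S M = diag(d) S. *)
Lemma int_multiplier_prod d : S \in unitmx -> int_multiplier S d ->
  exists2 M : 'M[int]_N, S *m map_mx intr M = diag_mx (\row_j d j) *m S &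
    \prod_j d j = (\det M)%:~R.
Proof.
move=> Su [M SM]; exists M => //; rewrite -det_map_mx.
have detS : \det S != 0 by rewrite unitmxE unitfE in Su.
apply: (mulfI detS); rewrite -det_mulmx SM det_mulmx det_diag mulrC.
by congr (_ * _); apply: eq_bigr => j _; rewrite mxE.
Qed.

(** If H is the integer matrix of h, then c + p H is the one of d^p, and its
    determinant is c^N modulo p; in 'F_p the Frobenius map is the identity. *)
Lemma int_multiplier_prod_mod p d c : prime p -> S \in unitmx ->
  frob_residue p S d c ->
  exists2 a : int, \prod_j d j = a%:~R & a%:~R = c%:~R ^+ N :> 'F_p.
Proof.
move=> p_pr Su [Md [h Mh dh]].
have [M _ detM] := int_multiplier_prod Su Md.
have [H SH _] := int_multiplier_prod Su Mh.
exists (\det M) => //.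
have detMp : (\det M) ^+ p = \det (c%:M + p%:Z *: H).
  apply: (@intr_inj R); rewrite rmorphXn /= -detM -prodrXl.
  have [|B SB ->] := @int_multiplier_prod (fun j => d j ^+ p) Su.
    exact: int_multiplierX.
  congr ((\det _)%:~R).
  suff /matrixP BH : map_mx intr B = map_mx intr (c%:M + p%:Z *: H) :> 'M[R]_N.
    apply/matrixP => i j; apply: (@intr_inj R).
    by have := BH i j; rewrite mxE [X in _ = X]mxE.
  apply: (can_inj (mulKmx Su)); rewrite SB map_mxD map_scalar_mx map_mxZ.
  rewrite mulmxDr mul_mx_scalar -scalemxAr SH scalemxAl -mul_scalar_mx -mulmxDl.
  congr (_ *m _); apply/matrixP => i j; rewrite !mxE dh.
  by case: eqP => _; rewrite ?mulr1n ?mulr0n ?mulr0 ?addr0.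
have := congr1 (fun a : int => a%:~R : 'F_p) detMp.
have fermat (x : 'F_p) : x ^+ p = x by have := expf_card x; rewrite card_Fp.
rewrite rmorphXn /= fermat => ->.
rewrite -det_map_mx map_mxD map_mxZ map_scalar_mx /= -pmulrn pchar_Fp_0 //.
by rewrite scale0r addr0 det_scalar.
Qed.

Lemma permanent_int (W : 'M[R]_N) : S \in unitmx ->
  (forall k, int_multiplier S (W^~ k)) -> exists a : int, permanent W = a%:~R.
Proof.
move=> Su MW; rewrite permanent_ryser.
have /fin_all_exists[a aW] (J : {set 'I_N}) : exists a : int,
    \prod_j (\sum_(k in J) W j k) = a%:~R.
  have [|M _ ->] := @int_multiplier_prod (fun j => \sum_(k in J) W j k) Su.
    exact: int_multiplier_sum.
  by exists (\det M).
exists (\sum_(J : {set 'I_N}) (-1) ^+ #|~: J| * a J).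
rewrite rmorph_sum /=; apply: eq_bigr => J _.
by rewrite rmorphM rmorphXn rmorphN1 /= aW.
Qed.

(** Each product in Ryser's formula may be reduced modulo p by replacing the
    k-th column by the constant c_k, which leaves the Ryser expansion of the
    permanent of a matrix with constant columns. *)
Lemma permanent_mod p (W : 'M[R]_N) (c : 'I_N -> int) :
  prime p -> S \in unitmx ->
  (forall k, frob_residue p S (W^~ k) (c k)) ->
  exists2 a : int, permanent W = a%:~R &
    a%:~R = N`!%:R * \prod_k (c k)%:~R :> 'F_p.
Proof.
move=> p_pr Su rW.
have /fin_all_exists2[a aW aJ] (J : {set 'I_N}) : exists2 a : int,
    \prod_j (\sum_(k in J) W j k) = a%:~R &
    a%:~R = (\sum_(k in J) c k)%:~R ^+ N :> 'F_p.
  by apply: int_multiplier_prod_mod => //; apply: frob_residue_sum.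
exists (\sum_(J : {set 'I_N}) (-1) ^+ #|~: J| * a J).
  rewrite permanent_ryser rmorph_sum /=; apply: eq_bigr => J _.
  by rewrite rmorphM rmorphXn rmorphN1 /= aW.
transitivity (permanent (\matrix_(j, k) (c k)%:~R) : 'F_p); last first.
  rewrite /permanent mulr_natl.
  transitivity (\sum_(t : 'S_N) \prod_k (c k)%:~R : 'F_p).
    apply: eq_bigr => t _; rewrite [RHS](reindex_perm t) /=.
    by apply: eq_bigr => j _; rewrite mxE.
  by rewrite sumr_const card_Sn.
rewrite permanent_ryser rmorph_sum /=; apply: eq_bigr => J _.
rewrite rmorphM rmorphXn rmorphN1 /= aJ; congr (_ * _).
under eq_bigr => j _ do under eq_bigr => k _ do rewrite mxE.
by rewrite prodr_const card_ord rmorph_sum.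
Qed.

End IntMultiplier.

(** * The angles 2 pi k / n *)

Definition angle (R : realType) (n k : nat) : R := 2 * pi * (k%:R / n%:R).

Lemma angleM (R : realType) n a b : angle R n (a * b) = angle R n a *+ b.
Proof. by rewrite /angle natrM -[RHS]mulr_natr; ring. Qed.

Lemma angleD (R : realType) n a b :
  angle R n (a + b) = angle R n a + angle R n b.
Proof. by rewrite /angle natrD; ring. Qed.

Lemma angle_turns (R : realType) n q : (0 < n)%N ->
  angle R n (n * q) = pi *+ 2 *+ q.
Proof.
move=> n_gt0; rewrite angleM /angle divff ?pnatr_eq0 -?lt0n //.
by rewrite mulr1 mulr_natl.
Qed.

Lemma sin_angleD_turns (R : realType) n a q : (0 < n)%N ->
  sin (angle R n (a + n * q)) = sin (angle R n a).
Proof.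
by move=> n0; rewrite angleD angle_turns // periodicn //; exact: sinD2pi.
Qed.

Lemma cos_angle_turns (R : realType) n q : (0 < n)%N ->
  cos (angle R n (n * q)) = 1.
Proof.
move=> n0; rewrite angle_turns // -[_ *+ q]add0r periodicn ?cos0 //.
exact: cosD2pi.
Qed.

Lemma sin_pi_frac_gt0 (R : realType) n t : (0 < t < n)%N ->
  0 < sin (pi * (t%:R / n%:R) : R).
Proof.
move=> /andP[t_gt0 tn]; have n_gt0 : (0 : R) < n%:R by rewrite ltr0n; lia.
rewrite sin_gt0_pi // mulrA; apply/andP; split.
  by rewrite divr_gt0 // mulr_gt0 ?pi_gt0 ?ltr0n.
by rewrite ltr_pdivrMr // ltr_pM2l ?pi_gt0 // ltr_nat.
Qed.

Lemma sin_pi_frac_mulrn (R : realType) n t : (0 < n)%N ->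
  sin (pi * (t%:R / n%:R) *+ n) = 0 :> R.
Proof.
move=> n_gt0; have -> : pi * (t%:R / n%:R) *+ n = 0 + pi *+ t :> R.
  rewrite add0r -[LHS]mulr_natr -[RHS]mulr_natr mulrA divfK //.
  by rewrite pnatr_eq0 -lt0n.
by rewrite alternatingn ?sin0 ?mulr0 //; exact: sinDpi.
Qed.

Lemma angle_double (R : realType) n k :
  angle R n k = pi * (k%:R / n%:R) *+ 2.
Proof. by rewrite /angle -mulr_natl; ring. Qed.

Lemma sin_angle_gt0 (R : realType) n k : (0 < k)%N -> (k.*2 < n)%N ->
  0 < sin (angle R n k).
Proof.
move=> k_gt0 kn; have -> : angle R n k = pi * (k.*2%:R / n%:R).
  by rewrite /angle -mul2n natrM; ring.
by apply: sin_pi_frac_gt0; lia.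
Qed.

(** * Cosines as integer multipliers of the sine matrix *)

Lemma sin_mxE (R : realType) n j k :
  sin_mx R n j k = sin (angle R n (j.+1 * k.+1)).
Proof. by rewrite mxE. Qed.

(** By periodicity and oddness of the sine, only the residues 1, ..., N of m
    matter, and they index the columns of the sine matrix. The coefficients v
    must not depend on j. *)
Lemma sin_angle_span (R : realType) n m : odd n ->
  exists v : 'I_((n - 1)./2) -> int, forall j : 'I_((n - 1)./2),
    sin (angle R n (j.+1 * m)) = \sum_i sin_mx R n j i * (v i)%:~R.
Proof.
move=> n_odd; have n_gt0 : (0 < n)%N by lia.
have red j : sin (angle R n (j * m)) = sin (angle R n (j * (m %% n))).
  rewrite {1}(divn_eq m n) mulnDr addnC [(_ %/ _ * _)%N]mulnC mulnCA.
  by rewrite sin_angleD_turns.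
have r_lt := ltn_pmod m n_gt0; move: (m %% n)%N r_lt red => r r_lt red.
have single (i0 : 'I_((n - 1)./2)) (c : int) j :
    \sum_i sin_mx R n j i * (c *+ (i == i0))%:~R = sin_mx R n j i0 * c%:~R.
  rewrite (bigD1 i0) //= eqxx big1 ?addr0 // => i /negPf ->.
  by rewrite mulr0n mulr0.
have [r0|r_gt0] := posnP r.
  exists (fun=> 0) => j; rewrite red r0 muln0.
  by rewrite {1}/angle mul0r mulr0 sin0 big1 // => i _; rewrite mulr0.
have [rN|rN] := leqP r (n - 1)./2.
  have i_lt : (r.-1 < (n - 1)./2)%N by lia.
  exists (fun i => 1 *+ (i == Ordinal i_lt)) => j.
  by rewrite red single mulr1 sin_mxE /= prednK.
have i_lt : ((n - r).-1 < (n - 1)./2)%N by lia.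
exists (fun i => -1 *+ (i == Ordinal i_lt)) => j.
rewrite red single mulrN1 sin_mxE /=.
have -> : (n - r).-1.+1 = (n - r)%N by lia.
apply/eqP; rewrite -addr_eq0; apply/eqP.
have : angle R n (j.+1 * r) =
       - angle R n (j.+1 * (n - r)) + angle R n (n * j.+1).
  have -> : (n * j.+1 = j.+1 * (n - r) + j.+1 * r)%N.
    by rewrite -mulnDr subnK ?(ltnW r_lt) // mulnC.
  by rewrite angleD addKr.
move=> ->; rewrite angle_turns // periodicn; last exact: sinD2pi.
by rewrite sinN addNr.
Qed.

(** The (k + 1)-st column, multiplied by 2 cos (m theta_j), becomes the sum of
    the sines of (k + 1 + m) theta_j and (k + 1 - m) theta_j. *)
Lemma int_multiplier_cos (R : realType) n m : odd n ->
  int_multiplier (sin_mx R n) (fun j => 2 * cos (angle R n (j.+1 * m))).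
Proof.
move=> n_odd; have n_gt0 : (0 < n)%N by lia.
have /fin_all_exists[v vE] (k : 'I_((n - 1)./2)) :
    exists v : 'I_((n - 1)./2) -> int, forall j : 'I_((n - 1)./2),
    2 * cos (angle R n (j.+1 * m)) * sin_mx R n j k =
      \sum_i sin_mx R n j i * (v i)%:~R.
  (* Modulo n, the multiplier (n - 1) m stands for - m in natural numbers. *)
  have [v1 v1E] := sin_angle_span R (k.+1 + m) n_odd.
  have [v2 v2E] := sin_angle_span R (k.+1 + n.-1 * m) n_odd.
  exists (fun i => v1 i + v2 i) => j.
  under eq_bigr => i _ do rewrite intrD mulrDr.
  rewrite big_split -v1E -v2E sin_mxE; move: (j.+1) (k.+1) => a b.
  rewrite !mulnDr !angleD.
  have -> : angle R n (a * (n.-1 * m)) =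
            - angle R n (a * m) + pi *+ 2 *+ (a * m).
    rewrite -(angle_turns R (a * m) n_gt0).
    have -> : (n * (a * m) = a * m + a * (n.-1 * m))%N.
      by rewrite -mulnDr -mulSn prednK // mulnCA.
    by rewrite angleD addKr.
  rewrite addrA periodicn; last exact: sinD2pi.
  by rewrite sinB sinD /=; ring.
exists (\matrix_(i, k) v k i); apply/matrixP => j k.
rewrite mul_diag_mx !mxE -/(angle R n _) -sin_mxE vE.
by apply: eq_bigr => i _; rewrite !mxE.
Qed.

(** Shifting the phase y by m x makes all the frequencies even and nonnegative,
    so that the identity is a plain induction with Pascal's rule. *)
Lemma exp_2cos (R : realType) (x y : R) m :
  (2 * cos x) ^+ m * cos (y + x *+ m) =
  \sum_(i < m.+1) 'C(m, i)%:R * cos (y + x *+ i.*2).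
Proof.
elim: m y => [|m IHm] y.
  by rewrite big_ord_recl big_ord0 !addr0 expr0 bin0.
transitivity ((2 * cos x) ^+ m * cos (y + x *+ 2 + x *+ m) +
              (2 * cos x) ^+ m * cos (y + x *+ m)).
  rewrite exprSr -mulrA -mulrDr; congr (_ * _).
  have -> : y + x *+ 2 + x *+ m = y + x *+ m.+1 + x by ring.
  have -> : y + x *+ m = y + x *+ m.+1 - x by ring.
  by move: (y + x *+ m.+1) => z; rewrite cosD cosB; ring.
rewrite !IHm [in RHS]big_ord_recl [X in _ + X = _]big_ord_recl /= !bin0 addrCA.
congr (_ + _).
transitivity (\sum_(i < m.+1)
    ('C(m, i.+1)%:R * cos (y + x *+ i.+1.*2) +
     'C(m, i)%:R * cos (y + x *+ i.+1.*2))); last first.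
  by apply: eq_bigr => i _; rewrite /= /bump /= add1n binS natrD mulrDl.
rewrite big_split /= addrC; congr (_ + _).
  by rewrite [in RHS]big_ord_recr /= ['C(m, m.+1)]bin_small // mul0r addr0.
apply: eq_bigr => i _; congr (_ * cos _).
by rewrite doubleS; ring.
Qed.

(** For x = m theta_j one has cos (p x) = 1, and the expansion of (2 cos x)^p
    has the end terms 1 and cos (2 p x) = 1. Twice the others is p times a
    multiplier H; the factor 2 is inverted by 2 ((p + 1)/2) = 1 + p. *)
Lemma frob_residue_cos (R : realType) p m : prime p -> odd p ->
  frob_residue p (sin_mx R p) (fun j => 2 * cos (angle R p (j.+1 * m))) 2.
Proof.
move=> p_pr p_odd; have p_gt0 := prime_gt0 p_pr.
split; first exact: int_multiplier_cos.
pose H j := \sum_(i < p.+1 | (0 < i < p)%N) ('C(p, i) %/ p)%N%:Z%:~R *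
              (2 * cos (angle R p (j * (m * i.*2)))) : R.
exists (fun j => (p.+1)./2%:Z%:~R * H j.+1 +
                 ((-1)%:~R * (2 * cos (angle R p (j.+1 * m))) ^+ p + 2%:~R)).
  apply: int_multiplierD.
    apply: int_multiplierM; first exact: int_multiplierC.
    apply: int_multiplier_sum => i _.
    apply: int_multiplierM; first exact: int_multiplierC.
    exact: int_multiplier_cos.
  apply: int_multiplierD; last exact: int_multiplierC.
  apply: int_multiplierM; first exact: int_multiplierC.
  by apply: int_multiplierX; exact: int_multiplier_cos.
move=> j; move: (j.+1) => a {j}.
have pE : p%:R = 2 * (p.+1)./2%:R - 1 :> R.
  by rewrite -natrM mul2n halfK /= p_odd subn0 -natr1 addrK.
suff E : 2 * ((2 * cos (angle R p (a * m))) ^+ p - 2) = p%:R * H a.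
  rewrite -pmulrn; set X := _ ^+ p in E *.
  rewrite mulrDr mulrCA -E pE; ring.
have := exp_2cos (angle R p (a * m)) 0 p.
have -> : cos (0 + angle R p (a * m) *+ p) = 1.
  by rewrite add0r -angleM mulnC cos_angle_turns.
rewrite mulr1 (bigD1 ord0) //= (bigD1 ord_max) /=; last first.
  by rewrite -val_eqE /= -lt0n.
rewrite addr0 cos0 bin0 binn !mul1r add0r -angleM.
have -> : (a * m * p.*2 = p * (a * m * 2))%N by rewrite -muln2; ring.
rewrite cos_angle_turns // => ->.
rewrite /H mulr_sumr.
set s := \sum_(i < _ | _) _.
have -> : 2 * (1 + (1 + s) - 2) = 2 * s by ring.
rewrite mulr_sumr; apply: eq_big => [i|i].
  by rewrite -!val_eqE /= lt0n ltn_neqAle -ltnS ltn_ord andbT.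
rewrite -!val_eqE /= -lt0n => /andP[i_gt0 i_ne].
have i_lt : (i < p)%N by rewrite ltn_neqAle i_ne -ltnS ltn_ord.
have pC : (p %| 'C(p, i))%N by rewrite prime_dvd_bin // i_gt0.
rewrite -pmulrn -{1}(divnK pC) natrM add0r -angleM mulnA; ring.
Qed.

(** * The ratios sin (m x) / sin x *)

(** U_m(x) = sin (m x) / sin x, as an integer combination of cosines; this
    expression keeps its meaning when sin x = 0. *)
Fixpoint sin_ratio (R : realType) (x : R) (m : nat) : R :=
  match m with
  | 0 => 0
  | m'.+1 => match m' with
             | 0 => 1
             | m''.+1 => 2 * cos (x *+ m') + sin_ratio x m''
             end
  end.

Lemma nat_ind2 (P : nat -> Prop) :
  P 0%N -> P 1%N -> (forall m, P m -> P m.+1 -> P m.+2) -> forall m, P m.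
Proof.
move=> P0 P1 PSS m; suff [] : P m /\ P m.+1 by [].
by elim: m => [|m [Pm PSm]]; split=> //; apply: PSS.
Qed.

Lemma sin_ratioE (R : realType) (x : R) m :
  sin (x *+ m) = sin x * sin_ratio x m.
Proof.
elim/nat_ind2: m => [||m IH _]; rewrite ?sin0 ?mulr0 ?mulr1 //.
rewrite [sin_ratio _ _]/= mulrDr -IH.
rewrite mulrSr sinD.
have -> : x *+ m = x *+ m.+1 - x by rewrite mulrSr addrK.
by rewrite sinB; ring.
Qed.

Lemma int_multiplier_ratio (R : realType) n t m : odd n ->
  int_multiplier (sin_mx R n) (fun j => sin_ratio (angle R n (j.+1 * t)) m).
Proof.
move=> n_odd; elim/nat_ind2: m => [||m IH _].
- exact: (int_multiplierC _ 0).
- exact: (int_multiplierC _ 1).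
have := int_multiplierD (int_multiplier_cos R (t * m.+1) n_odd) IH.
by apply: eq_int_multiplier => j; rewrite mulnA angleM.
Qed.

Lemma frob_residue_ratio (R : realType) p t m : prime p -> odd p ->
  frob_residue p (sin_mx R p) (fun j => sin_ratio (angle R p (j.+1 * t)) m) m.
Proof.
move=> p_pr p_odd; elim/nat_ind2: m => [||m IH _].
- exact: frob_residue0.
- split; first exact: (int_multiplierC _ 1).
  exists (fun=> 0); first exact: (int_multiplierC _ 0).
  by move=> j; rewrite expr1n mulr0 addr0.
have := frob_residueD p_pr (frob_residue_cos R (t * m.+1) p_pr p_odd) IH.
rewrite (_ : 2 + m%:Z = m.+2) //.
by apply: eq_frob_residue => j; rewrite mulnA angleM.
Qed.

(** * Invertibility of the sine matrix *)

(** Multiplied by sin (pi t / n), the sum telescopes, and its last term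
    sin (pi t) vanishes. *)
Lemma sum_cos_angle (R : realType) n t : odd n -> (0 < t < n)%N ->
  \sum_(k < (n - 1)./2) 2 * cos (angle R n (t * k.+1)) = -1.
Proof.
move=> n_odd /andP[t_gt0 tn].
pose x : R := pi * (t%:R / n%:R).
have xE k : angle R n (t * k) = x *+ k.*2.
  by rewrite angleM angle_double -mulrnA mul2n.
have sinx : sin x != 0 by rewrite gt_eqF // sin_pi_frac_gt0 // t_gt0.
have tele m : sin x * \sum_(k < m) 2 * cos (x *+ k.+1.*2) =
              sin (x *+ m.*2.+1) - sin x.
  elim: m => [|m IHm]; first by rewrite big_ord0 mulr0 subrr.
  rewrite big_ord_recr /= mulrDr IHm.
  have -> : x *+ m.*2.+1 = x *+ m.+1.*2 - x.
    by rewrite doubleS [in RHS]mulrSr addrK.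
  have -> : x *+ m.+1.*2.+1 = x *+ m.+1.*2 + x by rewrite mulrSr.
  by move: (x *+ m.+1.*2) => z; rewrite sinB sinD; ring.
under eq_bigr => k _ do rewrite xE.
apply: (mulfI sinx); rewrite tele mulrN1.
have -> : (((n - 1)./2).*2.+1 = n)%N by lia.
by rewrite sin_pi_frac_mulrn ?add0r //; lia.
Qed.

(** The rows are orthogonal of squared length n / 4: the scalar product of two
    rows is a difference of two cosine sums, which cancel unless the rows are
    equal. *)
Lemma sin_mx_unit (R : realType) n : odd n -> sin_mx R n \in unitmx.
Proof.
move=> n_odd; have n_gt0 : (0 < n)%N by lia.
have cos_ne (a b : nat) : (0 < a < b)%N -> (b < n)%N ->
    \sum_(k < (n - 1)./2)
      2 * cos (angle R n (b * k.+1) - angle R n (a * k.+1)) = -1.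
  move=> /andP[a_gt0 ab] bn.
  rewrite -(@sum_cos_angle R n (b - a)) //; last by lia.
  apply: eq_bigr => k _.
  by rewrite -{1}(subnK (ltnW ab)) mulnDl angleD addrK.
have SS : sin_mx R n *m (4 *: (sin_mx R n)^T) = n%:R%:M.
  apply/matrixP => j l; rewrite mxE [RHS]mxE.
  have -> : \sum_k sin_mx R n j k * (4 *: (sin_mx R n)^T) k l =
    \sum_(k < (n - 1)./2)
      2 * cos (angle R n (j.+1 * k.+1) - angle R n (l.+1 * k.+1)) -
    \sum_(k < (n - 1)./2) 2 * cos (angle R n ((j.+1 + l.+1) * k.+1)).
    rewrite -sumrB; apply: eq_bigr => k _.
    rewrite !mxE mulnDl angleD -!/(angle R n _).
    by rewrite cosB cosD; ring.
  rewrite sum_cos_angle //; last first.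
    by have := ltn_ord j; have := ltn_ord l; lia.
  have jn : (j.+1 < n)%N by have := ltn_ord j; lia.
  have ln : (l.+1 < n)%N by have := ltn_ord l; lia.
  have [->|jl] := eqVneq j l.
    under eq_bigr => k _ do rewrite subrr cos0 mulr1.
    rewrite sumr_const card_ord opprK mulr1n -mulrnA natr1; congr _%:R.
    by lia.
  rewrite mulr0n; apply/eqP; rewrite subr_eq0; apply/eqP.
  have [lt_jl|lt_lj|/val_inj eq_jl] := ltngtP j l.
  - under eq_bigr => k _ do rewrite -cosN opprB.
    exact: cos_ne.
  - exact: cos_ne.
  by rewrite eq_jl eqxx in jl.
suff: sin_mx R n *m (n%:R^-1 *: (4 *: (sin_mx R n)^T)) = 1%:M.
  by case/mulmx1_unit.
by rewrite -scalemxAr SS scale_scalar_mx mulVf // pnatr_eq0 -lt0n.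
Qed.

(** * The product of the sines of the angles theta_j *)

(** The polynomial f_m with f_m(2 cos 2y) = sin ((2m + 1) y) / sin y, that is,
    the Chebyshev polynomial of the third or fourth kind (up to convention)
    in X / 2. The numbers 2 cos theta_j are the roots of f_N. *)
Fixpoint sin_odd_poly (R : nzRingType) (m : nat) : {poly R} :=
  match m with
  | 0 => 1
  | m'.+1 => match m' with
             | 0 => 'X + 1
             | m''.+1 => 'X * sin_odd_poly R m' - sin_odd_poly R m''
             end
  end.

Lemma sin_odd_polySS (R : nzRingType) m :
  sin_odd_poly R m.+2 = 'X * sin_odd_poly R m.+1 - sin_odd_poly R m.
Proof. by []. Qed.

Lemma size_monic_sin_odd_poly (R : idomainType) m :
  size (sin_odd_poly R m) = m.+1 /\ sin_odd_poly R m \is monic.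
Proof.
elim/nat_ind2: m => [||m [s0 m0] [s1 m1]].
- by rewrite size_poly1 monic1.
- by rewrite /= -[1]opprK -polyC1 -polyCN size_XsubC monicXsubC.
have sX : size ('X * sin_odd_poly R m.+1) = m.+3.
  by rewrite mulrC size_mulX ?monic_neq0 // s1.
have s_lt : (size (- sin_odd_poly R m)%R < size ('X * sin_odd_poly R m.+1)%R)%N.
  by rewrite size_polyN s0 sX.
rewrite sin_odd_polySS size_polyDl // sX; split=> //.
by rewrite monicE lead_coefDl // lead_coefM lead_coefX (monicP m1) mul1r.
Qed.

Lemma sin_odd_poly2 (R : comNzRingType) m : (sin_odd_poly R m).[2] = m.*2.+1%:R.
Proof.
elim/nat_ind2: m => [||m IH0 IH1]; first by rewrite hornerC.
  by rewrite !hornerE /= natr1.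
rewrite sin_odd_polySS !hornerE IH0 IH1 !doubleS -!natr1; ring.
Qed.

Lemma sin_odd_polyN2 (R : comNzRingType) m :
  (sin_odd_poly R m).[-2] = (-1) ^+ m.
Proof.
elim/nat_ind2: m => [||m IH0 IH1]; first by rewrite hornerC.
  by rewrite !hornerE; ring.
rewrite sin_odd_polySS !hornerE IH0 IH1 !exprS; ring.
Qed.

Lemma sin_odd_poly_cos (R : realType) m (y : R) :
  (sin_odd_poly R m).[2 * cos (y *+ 2)] * sin y = sin (y *+ m.*2.+1).
Proof.
elim/nat_ind2: m => [||m IH0 IH1]; first by rewrite hornerC mul1r.
  rewrite !hornerE /= -[1.*2.+1]/(2.+1) mulrSr sinD sin_mulr2n cos_mulr2n.
  ring.
rewrite sin_odd_polySS !hornerE mulrDl mulNr IH0 -mulrA IH1.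
have -> : y *+ m.+2.*2.+1 = y *+ m.+1.*2.+1 + y *+ 2.
  by rewrite -mulrnDr !doubleS addn2.
have -> : y *+ m.*2.+1 = y *+ m.+1.*2.+1 - y *+ 2.
  by rewrite doubleS -addn2 mulrnDr addrK.
by move: (y *+ m.+1.*2.+1) (y *+ 2) => a b; rewrite sinB sinD; ring.
Qed.

(** Both sides are positive. As 4 - u^2 = (2 - u) (2 + u), with
    u_j = 2 cos theta_j the square of the left side is, up to the sign (-1)^N,
    f_N(2) f_N(-2), where f_N(2) = n and f_N(-2) = (-1)^N. *)
Lemma prod_2sin_angle (R : realType) n : odd n ->
  \prod_(j < (n - 1)./2) (2 * sin (angle R n j.+1)) = Num.sqrt n%:R.
Proof.
move=> n_odd; set N := (n - 1)./2; have nE : n = N.*2.+1 by rewrite /N; lia.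
have n_gt0 : (0 : R) < n%:R by rewrite ltr0n; lia.
pose u (j : 'I_N) : R := 2 * cos (angle R n j.+1).
have pE : sin_odd_poly R N = \prod_(j < N) ('X - (u j)%:P).
  have [szN monN] := size_monic_sin_odd_poly R N.
  pose rs := [seq u j | j <- enum 'I_N].
  rewrite (@all_roots_prod_XsubC _ (sin_odd_poly R N) rs).
  - by rewrite (monicP monN) scale1r big_map big_enum.
  - by rewrite size_map size_enum_ord.
  - apply/allP => _ /mapP[j _ ->]; rewrite rootE.
    pose y : R := pi * (j.+1%:R / n%:R).
    have siny : sin y != 0.
      by rewrite gt_eqF // sin_pi_frac_gt0 //; have := ltn_ord j; lia.
    rewrite -(inj_eq (mulIf siny)) mul0r /u angle_double sin_odd_poly_cos -nE.
    by rewrite sin_pi_frac_mulrn //; lia.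
  rewrite uniq_rootsE map_inj_uniq ?enum_uniq // => i j.
  have two0 : (2 : R) != 0 by rewrite pnatr_eq0.
  move=> /(mulfI two0) cos_eq.
  have ang_in (k : 'I_N) : angle R n k.+1 \in `[0, pi].
    have k_lt := ltn_ord k.
    rewrite in_itv /= /angle mulrA; apply/andP; split.
      by rewrite divr_ge0 ?ler0n // !mulr_ge0 ?pi_ge0 ?ler0n.
    rewrite ler_pdivrMr // -mulrA [leLHS]mulrCA ler_pM2l ?pi_gt0 //.
    by rewrite -natrM ler_nat; lia.
  have : angle R n i.+1 = angle R n j.+1 by apply: cos_inj.
  have pi20 : 2 * pi != 0 :> R by rewrite mulf_neq0 // gt_eqF ?pi_gt0.
  move=> /(mulfI pi20) /(mulIf (invr_neq0 (lt0r_neq0 n_gt0))) /eqP.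
  by rewrite eqr_nat eqSS => /eqP/val_inj.
have sin_gt0 (j : 'I_N) : 0 < sin (angle R n j.+1).
  by apply: sin_angle_gt0 => //; have := ltn_ord j; lia.
apply/eqP; rewrite -(@eqrXn2 _ 2) ?sqrtr_ge0 //; last first.
  by apply: prodr_ge0 => j _; rewrite mulr_ge0 ?ltW.
rewrite sqr_sqrtr ?ltW // -prodrXl; apply/eqP.
transitivity (\prod_(j < N) ((2 - u j) * (- (-2 - u j)))).
  by apply: eq_bigr => j _; rewrite exprMn sin2cos2 /u; ring.
rewrite big_split /= prodrN card_ord.
have hp c : (\prod_(j < N) ('X - (u j)%:P)).[c] = \prod_(j < N) (c - u j).
  by rewrite horner_prod; apply: eq_bigr => j _; rewrite !hornerE.
rewrite -!hp -pE sin_odd_poly2 sin_odd_polyN2 -exprMn mulrNN mulr1 expr1n mulr1.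
by rewrite -nE.
Qed.

(** * The normalized permanents without square roots *)

Lemma permanent_scale_rows (K : comPzRingType) (N : nat) (a : 'I_N -> K)
    (B : 'M[K]_N) :
  permanent (\matrix_(j, k) (a j * B j k)) = (\prod_j a j) * permanent B.
Proof.
rewrite /permanent big_distrr /=; apply: eq_bigr => t _.
by rewrite -big_split; apply: eq_bigr => j _; rewrite mxE.
Qed.

Lemma prod_sin_angle (R : realType) n : odd n ->
  \prod_(j < (n - 1)./2) sin (angle R n j.+1) =
  Num.sqrt n%:R / 2 ^+ (n - 1)./2.
Proof.
move=> n_odd; rewrite -(prod_2sin_angle R n_odd) big_split /= prodr_const.
by rewrite card_ord mulrAC divff ?mul1r // expf_neq0 // pnatr_eq0.
Qed.

Lemma sin_perE (R : realType) n : odd n ->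
  sin_per R n = permanent (\matrix_(j < (n - 1)./2, k < (n - 1)./2)
                             sin_ratio (angle R n (j.+1 * 1)) k.+1).
Proof.
move=> n_odd; have n_gt0 : (0 < n)%N by lia.
have sqrt_n : Num.sqrt n%:R != 0 :> R by rewrite gt_eqF ?sqrtr_gt0 ?ltr0n.
have two_n : 2 ^+ (n - 1)./2 != 0 :> R by rewrite expf_neq0 // pnatr_eq0.
rewrite /sin_per; set W := (X in _ = permanent X).
have -> : sin_mx R n = \matrix_(j, k) (sin (angle R n j.+1) * W j k).
  by apply/matrixP => j k; rewrite sin_mxE !mxE muln1 -sin_ratioE -angleM.
rewrite permanent_scale_rows prod_sin_angle // mulrA; set P := permanent _.
by field; rewrite sqrt_n two_n.
Qed.

(** With k m_k = 1 mod n, sin theta_j = sin (m_k (k theta_j)) is the product of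
    sin (k theta_j) and U_(m_k)(k theta_j); in particular sin (k theta_j) is
    nonzero. *)
Lemma csc_perE (R : realType) n (m : 'I_((n - 1)./2) -> nat) : odd n ->
  (forall k : 'I_((n - 1)./2), exists q, (k.+1 * m k = n * q + 1)%N) ->
  csc_per R n = permanent (\matrix_(j < (n - 1)./2, k < (n - 1)./2)
                             sin_ratio (angle R n (j.+1 * k.+1)) (m k)).
Proof.
move=> n_odd mP; have n_gt0 : (0 < n)%N by lia.
have sqrt_n : Num.sqrt n%:R != 0 :> R by rewrite gt_eqF ?sqrtr_gt0 ?ltr0n.
have two_n : 2 ^+ (n - 1)./2 != 0 :> R by rewrite expf_neq0 // pnatr_eq0.
rewrite /csc_per; set W := (X in _ = permanent X).
have sin_neq0 (j : 'I_((n - 1)./2)) : sin (angle R n j.+1) != 0.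
  by rewrite gt_eqF // sin_angle_gt0 //; have := ltn_ord j; lia.
have -> : csc_mx R n = \matrix_(j, k) ((sin (angle R n j.+1))^-1 * W j k).
  apply/matrixP => j k; rewrite !mxE /csc -/(angle R n _).
  have sinE : sin (angle R n j.+1) = sin (angle R n (j.+1 * k.+1)) *
                sin_ratio (angle R n (j.+1 * k.+1)) (m k).
    have [q kmE] := mP k.
    rewrite -sin_ratioE -angleM -mulnA kmE mulnDr muln1 addnC mulnCA.
    by rewrite sin_angleD_turns.
  have := sin_neq0 j; rewrite sinE mulf_eq0 negb_or => /andP[s0 r0].
  by field; rewrite s0 r0.
rewrite permanent_scale_rows prodfV prod_sin_angle // mulrA.
set P := permanent _.
by field; rewrite sqrt_n two_n.
Qed.

(** * Congruences *)

Lemma eqz_mod_Fp p (a b : int) : prime p -> a%:~R = b%:~R :> 'F_p ->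
  (a = b %[mod p])%Z.
Proof.
move=> p_pr ab; apply/eqP; rewrite eqz_mod_dvd (dvdz_pcharf (pchar_Fp p_pr)).
by rewrite rmorphB /= ab subrr.
Qed.

Lemma prod_succ_ord (K : comPzRingType) m :
  \prod_(k < m) (k.+1)%:R = m`!%:R :> K.
Proof. by rewrite fact_prod big_add1 big_mkord natr_prod. Qed.

(** Pairing k with p - k = - k in (p - 1)! = - 1. *)
Lemma wilson_half p : prime p -> odd p ->
  ((p - 1)./2)`!%:R ^+ 2 = (-1) ^+ (p + 1)./2 :> 'F_p.
Proof.
move=> p_pr p_odd; set N := (p - 1)./2.
have pE : p = N.*2.+1 by have := prime_gt0 p_pr; rewrite /N; lia.
have wilson : (N.*2)`!%:R = -1 :> 'F_p.
  apply/eqP; rewrite -subr_eq0 opprK natr1 -(dvdn_pcharf (pchar_Fp p_pr)).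
  have -> : N.*2 = p.-1 by lia.
  by rewrite -Wilson ?prime_gt1.
have split : (N.*2)`!%:R = (-1) ^+ N * N`!%:R ^+ 2 :> 'F_p.
  rewrite -addnn -(prod_succ_ord _ (N + N)) big_split_ord /= prod_succ_ord.
  rewrite expr2 mulrCA; congr (_ * _).
  rewrite (reindex_inj rev_ord_inj) /= -prod_succ_ord.
  rewrite -[in (-1) ^+ N](card_ord N) -prodrN; apply: eq_bigr => k _.
  apply/eqP; rewrite -addr_eq0 -natrD -(dvdn_pcharf (pchar_Fp p_pr)).
  have -> : ((N + (N - k.+1)).+1 + k.+1 = p)%N by have := ltn_ord k; lia.
  exact: dvdnn.
have -> : ((p + 1)./2 = N.+1)%N by lia.
rewrite [RHS]exprS -[X in _ = X * _]wilson split mulrAC -exprMn.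
by rewrite mulrNN mul1r expr1n mul1r.
Qed.

Theorem theorem6 (R : realType) :
  (forall n : nat, odd n -> (1 < n)%N -> sin_per R n \is a Num.int) /\
  (forall p : nat, prime p -> odd p -> csc_per R p \is a Num.int) /\
  (forall p : nat, prime p -> odd p ->
     (exists2 a : int, sin_per R p = a%:~R &
        (a = (-1) ^+ (p + 1)./2 %[mod p])%Z) /\
     (exists2 b : int, csc_per R p = b%:~R & (b = 1 %[mod p])%Z)).
Proof.
have csc_mod p : prime p -> odd p ->
    exists2 b : int, csc_per R p = b%:~R & (b = 1 %[mod p])%Z.
  move=> p_pr p_odd.
  have /fin_all_exists[m mP] (k : 'I_((p - 1)./2)) :
      exists m q, (k.+1 * m = p * q + 1)%N.
    case: (egcdnP p (ltn0Sn k)) => m q mE _; exists m, q.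
    have /eqP gcd1 : coprime k.+1 p.
      rewrite coprime_sym prime_coprime // gtnNdvd //.
      by have := ltn_ord k; lia.
    by rewrite mulnC mE gcd1 mulnC.
  rewrite (csc_perE R p_odd mP).
  have [|b -> b_mod] := @permanent_mod _ _ _ p
    (\matrix_(j < (p - 1)./2, k < (p - 1)./2)
       sin_ratio (angle R p (j.+1 * k.+1)) (m k)) m p_pr (sin_mx_unit R p_odd).
    move=> k.
    apply: eq_frob_residue (frob_residue_ratio R k.+1 (m k) p_pr p_odd) => j.
    by rewrite mxE.
  exists b => //; apply: eqz_mod_Fp => //.
  rewrite b_mod -prod_succ_ord -big_split /= big1 // => k _.
  have [q kmE] := mP k.
  by rewrite -pmulrn -natrM kmE natrD natrM pchar_Fp_0 // mul0r add0r.
split=> [n n_odd _|].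
  have [|a aE] := @permanent_int _ _ _
    (\matrix_(j < (n - 1)./2, k < (n - 1)./2)
       sin_ratio (angle R n (j.+1 * 1)) k.+1) (sin_mx_unit R n_odd).
    move=> k; apply: eq_int_multiplier (int_multiplier_ratio R 1 k.+1 n_odd).
    by move=> j; rewrite mxE.
  by rewrite sin_perE // aE intr_int.
split=> [p p_pr p_odd|p p_pr p_odd].
  by have [b -> _] := csc_mod p p_pr p_odd; rewrite intr_int.
split; last exact: csc_mod.
have [|a aE a_mod] := @permanent_mod _ _ _ p
  (\matrix_(j < (p - 1)./2, k < (p - 1)./2)
     sin_ratio (angle R p (j.+1 * 1)) k.+1) (fun k => k.+1) p_pr
  (sin_mx_unit R p_odd).
  move=> k; apply: eq_frob_residue (frob_residue_ratio R 1 k.+1 p_pr p_odd).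
  by move=> j; rewrite mxE.
exists a; first by rewrite sin_perE.
apply: eqz_mod_Fp => //.
by rewrite a_mod rmorphXn rmorphN1 /= -wilson_half // expr2 prod_succ_ord.
Qed.
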